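(* Let $\mathcal X\subseteq\mathbb R^{D_x}$ be compact with $\sup_{x\in\mathcal X}\|x\|\le R_x$. Suppose there is a nondecreasing function $\varepsilon:\mathbb R_+\to\mathbb R_+$ of at most polynomial growth such that for every fixed $z\in\mathcal X$ and every $\delta\in(0,1)$, with probability at least $1-\delta$, $$\mathbb E_{\mathbb P^\star}[\ell(z,\xi)]-\mathbb E_{\hat{\mathbb P}_N}[\ell(z,\xi)]\le\frac1{\sqrt N}\,\varepsilon\!\left(\log\frac1\delta\right).$$ Let $L=\max_{j\in[J]}\|\mathbf A_j\|_{\mathrm{op}}\sqrt\Omega+\max_{j\in[J]}\|\mathbf b_j\|$. Then for every $\delta\in(0,1)$, setting the radius to $$\epsilon=\frac1{\sqrt N}\left(\varepsilon\!\left(D_x\log\big(1+2R_xL\sqrt N\big)+\log\frac1\delta\right)+2\right)$$ ensures that $\mathbb P^\star\in\mathcal P_\epsilon$ with probability at least $1-\delta$.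
   Context: The decision set $\mathcal X\subseteq\mathbb R^{D_x}$ is compact and convex, and $\Xi\subseteq\mathbb R^{D_\xi}$ is the support set of the random vector $\xi$; $\mathscr P(\Xi)$ is the set of probability distributions on $\Xi$. The loss is $\ell(x,\xi)=\max_{j\in[J]}\big(a_j(x)^\top\xi+b_j(x)\big)$ with $a_j(x)=\mathbf A_jx+\bar{\mathbf a}_j$ and $b_j(x)=\mathbf b_j^\top x+\bar b_j$, and $c_1,c_2\ge 0$ satisfy $|\ell(x,\xi)|\le c_1+c_2\|\xi\|$ for all $x\in\mathcal X$, $\xi\in\Xi$. $\mathbb P^\star$ is the true distribution; $\hat{\mathbb P}_N$ is a reference distribution on $\Xi$ constructed from $N$ random data points, and ''with probability'' refers to the randomness of the data. The constant $\Omega$ satisfies $\mathbb E_{\hat{\mathbb P}_N}[\|\xi\|^2]<\Omega$ and $\mathbb E_{\mathbb P^\star}[\|\xi\|^2]\le\Omega$. $\mathbb Z$ is a probability distribution with full support on $\mathcal X$, $[u]_+=\max\{u,0\}$, and $$\mathcal P_\epsilon=\Big\{\mathbb Q\in\mathscr P(\Xi):\ \mathbb E_{z\sim\mathbb Z}\big[\big[\mathbb E_{\mathbb Q}[\ell(z,\xi)]-\mathbb E_{\hat{\mathbb P}_N}[\ell(z,\xi)]-\epsilon\big]_+\big]\le 0,\ \mathbb E_{\mathbb Q}[\|\xi\|^2]\le\Omega\Big\}.$$ $\|\cdot\|$ is the Euclidean norm and $\|\cdot\|_{\mathrm{op}}$ the operator norm. *)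

(* Defs.v *)
From HB Require Import structures.
From mathcomp Require Export all_boot all_order all_algebra.
From mathcomp Require Export all_classical all_reals all_analysis.

Set Implicit Arguments.
Unset Strict Implicit.
Unset Printing Implicit Defensive.

Import Order.TTheory GRing.Theory Num.Theory.
Import numFieldNormedType.Exports.

Local Open Scope classical_set_scope.
Local Open Scope ring_scope.

(** The library norm on matrices is the entrywise maximum, so the Euclidean
    norm is defined here.  The library topology on ['cV[R]_n] is the product
    topology, i.e. the Euclidean one. *)
Definition norm2 (R : realType) (n : nat) (v : 'cV[R]_n) : R :=
  Num.sqrt (\sum_(i < n) v i 0 ^+ 2).

Definition opnorm2 (R : realType) (m n : nat) (A : 'M[R]_(m, n)) : R :=
  sup [set norm2 (A *m v) | v in [set v : 'cV[R]_n | norm2 v <= 1]].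

Definition borelRn (R : realType) (n : nat) :=
  g_sigma_algebraType [set U : set 'cV[R]_n | open U].

(** Maximum of a family indexed by the nonempty set ['I_n.+1]; starting the
    fold at one of the values makes it a genuine maximum, also when all the
    values are negative. *)
Definition fmax (R : realType) (n : nat) (F : 'I_n.+1 -> R) : R :=
  \big[Num.max/F ord0]_(j < n.+1) F j.

(** The pieces are indexed by ['I_J.+1]: there are [J.+1 >= 1] of them. *)
Definition loss (R : realType) (Dx Dxi J : nat)
    (A : 'I_J.+1 -> 'M[R]_(Dxi, Dx)) (abar : 'I_J.+1 -> 'cV[R]_Dxi)
    (b : 'I_J.+1 -> 'cV[R]_Dx) (bbar : 'I_J.+1 -> R)
    (x : 'cV[R]_Dx) (xi : 'cV[R]_Dxi) : R :=
  fmax (fun j => ((A j *m x + abar j)^T *m xi) 0 0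
                 + (((b j)^T *m x) 0 0 + bbar j)).

Definition lipschitz_const (R : realType) (Dx Dxi J : nat)
    (A : 'I_J.+1 -> 'M[R]_(Dxi, Dx)) (b : 'I_J.+1 -> 'cV[R]_Dx)
    (Omega : R) : R :=
  fmax (fun j => opnorm2 (A j)) * Num.sqrt Omega + fmax (fun j => norm2 (b j)).

(** Distributions on a Borel set [S] of R^n are represented as Borel
    probabilities on R^n giving mass one to [S]. *)
Definition probs_on (R : realType) (n : nat) (S : set 'cV[R]_n) :
    set (probability (borelRn R n) R) :=
  [set Q | Q S = 1%:E].

Definition full_support (R : realType) (n : nat) (X : set 'cV[R]_n)
    (Z : probability (borelRn R n) R) : Prop :=
  probs_on X Z /\
  forall U : set 'cV[R]_n, open U -> U `&` X !=set0 -> (0 < Z U)%E.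

Definition expected_loss (R : realType) (Dx Dxi : nat)
    (l : 'cV[R]_Dx -> 'cV[R]_Dxi -> R) (Q : probability (borelRn R Dxi) R)
    (z : 'cV[R]_Dx) : \bar R :=
  'E_Q[fun xi : borelRn R Dxi => l z xi]%E.

Definition second_moment (R : realType) (n : nat)
    (Q : probability (borelRn R n) R) : \bar R :=
  'E_Q[fun xi : borelRn R n => (norm2 xi ^+ 2)%R]%E.

Definition ambiguity_set (R : realType) (Dx Dxi : nat)
    (X : set 'cV[R]_Dx) (Xi : set 'cV[R]_Dxi)
    (l : 'cV[R]_Dx -> 'cV[R]_Dxi -> R) (Z : probability (borelRn R Dx) R)
    (Omega : R) (Phat : probability (borelRn R Dxi) R) (eps : R) :
    set (probability (borelRn R Dxi) R) :=
  [set Q | [/\ probs_on Xi Q,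
    (\int[Z]_(z in X)
       maxe (expected_loss l Q z - expected_loss l Phat z - eps%:E) 0 <= 0)%E &
    (second_moment Q <= Omega%:E)%E]].

(** "[E] holds with probability at least [p]": for a measurable event this is
    [p <= P E]; in general [E] must contain a measurable event of probability
    at least [p] (a measure takes meaningless values on nonmeasurable sets), so
    no measurability of the reference distribution in the data is needed. *)
Definition with_prob_at_least (R : realType) (d : measure_display)
    (T : measurableType d) (P : probability T R) (p : R) (E : set T) : Prop :=
  exists F : set T, [/\ measurable F, F `<=` E & (p%:E <= P F)%E].

Definition poly_growth (R : realType) (e : R -> R) : Prop :=
  exists (C : R) (k : nat), forall t : R, 0 <= t -> e t <= C * (1 + t) ^+ k.

(* Main.v *)
Require Import Defs.
From mathcomp Require Import measurable_realfun ring lra.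

Set Implicit Arguments.
Unset Strict Implicit.
Unset Printing Implicit Defensive.

Import Order.TTheory GRing.Theory Num.Theory.
Import numFieldNormedType.Exports.

Local Open Scope classical_set_scope.
Local Open Scope ring_scope.

(** Write [G z] for the expected loss of the decision [z] under [Pstar] minus
    its expected loss under [Phat w].  Each expected loss is [L]-Lipschitz in
    [z] for the Euclidean norm ([expected_loss_lipschitz]), because the loss is a
    maximum of functions whose slopes in [z] are at most
    [opnorm2 (A j) * norm2 xi + norm2 (b j)], and a second moment at most [Omega]
    bounds the mean of [norm2 xi] by the square root of [Omega].  Hence [G] varies
    by at most [2 / sqrt N] on a ball of radius [1 / (L * sqrt N)].

    Cover [X] by such balls centred in [X].  A maximal separated subset of [X]
    provides a net of at most [(1 + 2 * Rx * L * sqrt N) ^ Dx] points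
    ([net_exists]).  Applying the pointwise bound at every point of the net with
    failure probability [delta] divided by the size of the net
    ([with_prob_forall]) gives, with probability at least [1 - delta], a bound on
    [G] over the whole net; the logarithm of the size of the net is the first
    term in the argument of [e], and the variation [2 / sqrt N] between net points
    is the summand [2] in the radius.  Then [G z <= eps] for all [z] in [X] at
    once, and the integrand in the definition of the ambiguity set vanishes.

    The bound on the number of separated points is usually proved by comparing
    volumes of balls.  Here it is derived by self-similarity ([packing_bound]):
    iterating a configuration inside shrunken copies of itself raises its
    cardinal to the [n]-th power, while counting cells of a grid bounds the
    cardinal up to a factor that does not depend on [n]; taking [n] large removes
    that factor and leaves the sharp volumetric constant. *)

(** * The Euclidean norm *)

Section EuclideanNorm.
Context {R : realType} {n : nat}.
Implicit Types u v w : 'cV[R]_n.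

Lemma norm2_ge0 v : 0 <= norm2 v.
Proof. exact: sqrtr_ge0. Qed.

Lemma sqr_norm2 v : norm2 v ^+ 2 = \sum_(i < n) v i 0 ^+ 2.
Proof. by rewrite sqr_sqrtr// sumr_ge0// => i _; exact: sqr_ge0. Qed.

Lemma norm2_0 : norm2 (0 : 'cV[R]_n) = 0.
Proof. by rewrite /norm2 big1 ?sqrtr0// => i _; rewrite mxE expr0n. Qed.

Lemma norm2_eq0 v : norm2 v = 0 -> v = 0.
Proof.
move=> v0; have /eqP : \sum_(i < n) v i 0 ^+ 2 = 0.
  by rewrite -sqr_norm2 v0 expr0n.
rewrite psumr_eq0; last by move=> i _; exact: sqr_ge0.
move=> /allP vi0; apply/colP => i; rewrite mxE; apply/eqP.
by rewrite -sqrf_eq0; apply: vi0; rewrite mem_index_enum.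
Qed.

Lemma norm2Z (a : R) v : norm2 (a *: v) = `|a| * norm2 v.
Proof.
rewrite /norm2 -sqrtr_sqr -sqrtrM ?sqr_ge0//; congr Num.sqrt.
by rewrite mulr_sumr; apply: eq_bigr => i _; rewrite mxE exprMn.
Qed.

Lemma norm2N v : norm2 (- v) = norm2 v.
Proof. by rewrite -scaleN1r norm2Z normrN1 mul1r. Qed.

Lemma norm2_distC u v : norm2 (u - v) = norm2 (v - u).
Proof. by rewrite -norm2N opprB. Qed.

(** Cauchy-Schwarz: expand the squared norm of [norm2 v *: u - norm2 u *: v]. *)
Lemma dot_le_norm2 u v : (u^T *m v) 0 0 <= norm2 u * norm2 v.
Proof.
rewrite mxE; under eq_bigr do rewrite mxE.
have [/norm2_eq0 ->|u0] := eqVneq (norm2 u) 0.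
  by rewrite norm2_0 mul0r big1// => i _; rewrite mxE mul0r.
have [/norm2_eq0 ->|v0] := eqVneq (norm2 v) 0.
  by rewrite norm2_0 mulr0 big1// => i _; rewrite mxE mulr0.
have uv0 : 0 < norm2 u * norm2 v by rewrite mulr_gt0// lt0r ?u0 ?v0 norm2_ge0.
have uv2 : 0 < 2 * (norm2 u * norm2 v) by rewrite mulr_gt0.
rewrite -subr_ge0 -(pmulr_rge0 _ uv2).
suff -> : 2 * (norm2 u * norm2 v) * (norm2 u * norm2 v - \sum_(i < n) u i 0 * v i 0)
    = \sum_(i < n) (norm2 v * u i 0 - norm2 u * v i 0) ^+ 2.
  by apply: sumr_ge0 => i _; exact: sqr_ge0.
under [RHS]eq_bigr => i _ do
  (rewrite (_ : _ ^+ 2 = norm2 v ^+ 2 * u i 0 ^+ 2 + norm2 u ^+ 2 * v i 0 ^+ 2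
    - 2 * (norm2 u * norm2 v) * (u i 0 * v i 0)); last by ring).
rewrite sumrB big_split/= -!mulr_sumr -!sqr_norm2; ring.
Qed.

Lemma norm2D u v : norm2 (u + v) <= norm2 u + norm2 v.
Proof.
rewrite -(@ler_pXn2r _ 2) ?nnegrE ?addr_ge0 ?norm2_ge0//.
have -> : norm2 (u + v) ^+ 2 = norm2 u ^+ 2 + norm2 v ^+ 2 + 2 * (u^T *m v) 0 0.
  rewrite !sqr_norm2 mxE mulr_sumr -!big_split/=; apply: eq_bigr => i _.
  by rewrite !mxE; ring.
have := dot_le_norm2 u v; lra.
Qed.

Lemma norm2_dist_ge u v : norm2 u - norm2 v <= norm2 (u - v).
Proof. by have := norm2D (u - v) v; rewrite subrK lerBlDr. Qed.

Lemma coord_le_norm2 v i : `|v i 0| <= norm2 v.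
Proof.
rewrite -sqrtr_sqr ler_wsqrtr// (bigD1 i)//= lerDl.
by apply: sumr_ge0 => j _; exact: sqr_ge0.
Qed.

Lemma norm2_le_sum v : norm2 v <= \sum_(i < n) `|v i 0|.
Proof.
have S0 : 0 <= \sum_(i < n) `|v i 0| by apply: sumr_ge0.
rewrite -(@ler_pXn2r _ 2) ?nnegrE ?norm2_ge0// sqr_norm2 expr2 mulr_suml.
apply: ler_sum => i _; rewrite -real_normK ?num_real// expr2.
by rewrite ler_wpM2l// (bigD1 i)//= lerDl sumr_ge0.
Qed.

End EuclideanNorm.

Section OperatorNorm.
Context {R : realType} {m n : nat} (A : 'M[R]_(m, n)).

Lemma has_ubound_opnorm2 :
  has_ubound [set norm2 (A *m v) | v in [set v : 'cV[R]_n | norm2 v <= 1]].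
Proof.
exists (\sum_(i < m) \sum_(j < n) `|A i j|) => _ [v /= v1 <-].
apply: (le_trans (norm2_le_sum _)); apply: ler_sum => i _.
rewrite mxE; apply: (le_trans (ler_norm_sum _ _ _)); apply: ler_sum => j _.
by rewrite normrM ler_piMr// (le_trans (coord_le_norm2 v j)).
Qed.

Lemma opnorm2_ge0 : 0 <= opnorm2 A.
Proof.
apply: (ub_le_sup has_ubound_opnorm2).
by exists 0; rewrite /= ?mulmx0 ?norm2_0.
Qed.

Lemma norm2_mulmx_le v : norm2 (A *m v) <= opnorm2 A * norm2 v.
Proof.
have [/norm2_eq0 ->|v0] := eqVneq (norm2 v) 0.
  by rewrite mulmx0 !norm2_0 mulr0.
have v_gt0 : 0 < norm2 v by rewrite lt0r v0 norm2_ge0.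
rewrite -ler_pdivrMr//; apply: (ub_le_sup has_ubound_opnorm2).
have normV : `|(norm2 v)^-1| = (norm2 v)^-1 by rewrite ger0_norm// invr_ge0 norm2_ge0.
exists ((norm2 v)^-1 *: v) => /=.
  by rewrite norm2Z normV mulVf.
by rewrite -scalemxAr norm2Z normV mulrC.
Qed.

End OperatorNorm.

(** * The packing bound *)

Section Packing.
Context {R : realType}.

(** Separated points lie in distinct cells of a cubic grid of mesh
    [s / D.+1], whose cells have Euclidean diameter below [s].  The constant is
    far from sharp; only the exponent [D] matters below. *)
Lemma separated_card_le_grid (D : nat) (I : finType) (y : I -> 'cV[R]_D)
    (rho s : R) :
  0 <= rho -> 0 < s -> (forall i, norm2 (y i) <= rho) ->
  (forall i j, i != j -> s <= norm2 (y i - y j)) ->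
  #|I|%:R <= (2 * rho / s * D.+1%:R + 1) ^+ D.
Proof.
move=> rho0 s0 ynorm ysep.
pose h := s / D.+1%:R.
have h0 : 0 < h by rewrite divr_gt0.
have -> : 2 * rho / s * D.+1%:R = 2 * rho / h.
  by rewrite /h invf_div; ring.
pose q i (k : 'I_D) := (y i k 0 + rho) / h.
have q0 i k : 0 <= q i k.
  rewrite divr_ge0 ?(ltW h0)// -lerBlDr sub0r.
  by have := le_trans (coord_le_norm2 (y i) k) (ynorm i); rewrite ler_norml => /andP[].
have qle i k : q i k <= 2 * rho / h.
  rewrite ler_wpM2r ?invr_ge0 ?(ltW h0)//.
  have := le_trans (coord_le_norm2 (y i) k) (ynorm i); rewrite ler_norml => /andP[_].
  lra.
pose K := Num.truncn (2 * rho / h).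
pose cell i : {ffun 'I_D -> 'I_K.+1} := [ffun k => inord (Num.truncn (q i k))].
have cell_inj : injective cell.
  move=> i j eq_cell; apply/eqP; apply/negP => /negP /ysep; apply/negP.
  rewrite -ltNge; apply: (le_lt_trans (norm2_le_sum _)).
  apply: (@le_lt_trans _ _ (\sum_(k < D) h)); last first.
    rewrite sumr_const card_ord -mulr_natl /h mulrCA gtr_pMr//.
    by rewrite ltr_pdivrMr// mul1r ltr_nat.
  apply: ler_sum => k _; rewrite !mxE.
  have : Num.truncn (q i k) = Num.truncn (q j k).
    have /ffunP /(_ k) := eq_cell; rewrite !ffunE => /(congr1 val) /=.
    by rewrite !inordK// ltnS le_truncn.
  move=> eq_trunc.
  have /andP[i1 i2] := truncn_itv (q0 i k).
  have /andP[j1 j2] := truncn_itv (q0 j k).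
  rewrite eq_trunc in i1 i2.
  have -> : y i k 0 - y j k 0 = (q i k - q j k) * h.
    by rewrite mulrBl !divfK ?gt_eqF//; ring.
  rewrite normrM (gtr0_norm h0) ler_piMl ?(ltW h0)//.
  by rewrite ler_norml; move: i1 i2 j1 j2; rewrite -natr1; lra.
have := leq_card cell cell_inj; rewrite card_ffun !card_ord => cardI.
apply: (@le_trans _ _ (K.+1 ^ D)%:R); first by rewrite ler_nat.
have M0 : 0 <= 2 * rho / h by rewrite divr_ge0 ?(ltW h0)// mulr_ge0.
rewrite natrX lerXn2r ?nnegrE ?addr_ge0//.
by rewrite -natr1 lerD2r truncn_le.
Qed.

(** Self-similar iteration: replacing each point [x i] by a copy of the [n]-th
    configuration contracted by [mu] multiplies the number of points by [#|I|].
    In terms of balls, [2 * rho * mu] is the separation [1] of the points [x i],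
    and the balls of radius [rho * mu ^+ n] around the points of the [n]-th
    configuration are disjoint and contained in the ball of radius [rho]. *)
Lemma separated_iterate (D : nat) (I : finType) (x : I -> 'cV[R]_D) (r : R) :
  0 <= r -> (forall i, norm2 (x i) <= r) ->
  (forall i j, i != j -> 1 <= norm2 (x i - x j)) ->
  let mu := (1 + 2 * r)^-1 in let rho := r + 2^-1 in
  forall n, exists (I' : finType) (y : I' -> 'cV[R]_D),
    [/\ #|I'| = (#|I| ^ n)%N,
        forall i, norm2 (y i) <= rho * (1 - mu ^+ n) &
        forall i j, i != j -> 2 * rho * mu ^+ n <= norm2 (y i - y j)].
Proof.
move=> r0 xnorm xsep mu rho.
have d0 : 0 < 1 + 2 * r by lra.
have mu0 : 0 <= mu by rewrite invr_ge0 ltW.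
have rhomu : 2 * (rho * mu) = 1.
  by rewrite /rho /mu; field; rewrite gt_eqF.
elim=> [|n [I' [y [cardI' ynorm ysep]]]].
  exists unit, (fun=> 0); split => [|_|[] []//]; first by rewrite card_unit.
  by rewrite norm2_0 expr0 subrr mulr0.
exists (I * I')%type, (fun p => x p.1 + mu *: y p.2); split.
- by rewrite card_prod cardI' expnS.
- move=> [i k] /=; apply: (le_trans (norm2D _ _)); rewrite norm2Z ger0_norm//.
  apply: (le_trans (lerD (xnorm i) (ler_wpM2l mu0 (ynorm k)))).
  rewrite exprS (_ : mu * (rho * _) = (2 * (rho * mu)) / 2 * (1 - mu ^+ n)); last by field.
  rewrite (_ : rho * (1 - _) = rho - (2 * (rho * mu)) / 2 * mu ^+ n); last by field.
  by rewrite rhomu /rho; lra.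
move=> [i k] [j l] /=; have [<- ijkl|ij _] := eqVneq i j.
  have kl : k != l by apply: contraNneq ijkl => ->.
  rewrite opprD addrACA subrr add0r -scalerBr norm2Z ger0_norm//.
  by rewrite exprS mulrCA ler_wpM2l// ysep.
rewrite opprD addrACA -scalerBr.
have := norm2_dist_ge (x i - x j) (- (mu *: (y k - y l))).
rewrite opprK norm2N norm2Z (ger0_norm mu0) => /(le_trans _); apply.
have ykl : norm2 (y k - y l) <= 2 * rho * (1 - mu ^+ n).
  apply: (le_trans (norm2D _ _)); rewrite norm2N.
  by have := ynorm k; have := ynorm l; lra.
have := ler_wpM2l mu0 ykl; rewrite exprS.
rewrite (_ : mu * (2 * rho * _) = 2 * (rho * mu) * (1 - mu ^+ n)); last by ring.
rewrite (_ : 2 * rho * (mu * _) = 2 * (rho * mu) * mu ^+ n); last by ring.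
rewrite rhomu; have := xsep _ _ ij; lra.
Qed.

Lemma le1_of_bounded_exprn (q B : R) : (forall n, q ^+ n <= B) -> q <= 1.
Proof.
move=> qB; rewrite leNgt; apply/negP => q1.
have bernoulli n : 1 + n%:R * (q - 1) <= q ^+ n.
  elim: n => [|n IH]; first by rewrite mul0r addr0.
  have := ler_wpM2l (ltW (lt_trans ltr01 q1)) IH; rewrite -exprS => /(le_trans _); apply.
  rewrite -natr1; have : 0 <= n%:R * (q - 1) ^+ 2 :> R by rewrite mulr_ge0 ?sqr_ge0.
  by nra.
have := truncnS_gt (B / (q - 1)); rewrite ltr_pdivrMr ?subr_gt0// => Blt.
have := le_trans (bernoulli (Num.truncn (B / (q - 1))).+1) (qB _); lra.
Qed.

(** The volumetric packing bound without volumes: if there were more than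
    [(1 + 2 * r) ^+ D] points, the cardinals of the iterated configurations
    would grow faster than the grid bound, which is of order
    [(1 + 2 * r) ^+ (n * D)], allows. *)
Lemma packing_bound (D : nat) (I : finType) (x : I -> 'cV[R]_D) (r : R) :
  0 <= r -> (forall i, norm2 (x i) <= r) ->
  (forall i j, i != j -> 1 <= norm2 (x i - x j)) ->
  #|I|%:R <= (1 + 2 * r) ^+ D.
Proof.
move=> r0 xnorm xsep.
have lam1 : 1 <= 1 + 2 * r by lra.
have lam0 : 0 < 1 + 2 * r by lra.
rewrite -[leRHS]mul1r -ler_pdivrMr ?exprn_gt0//.
apply: (@le1_of_bounded_exprn _ (D.+2%:R ^+ D)) => n.
rewrite expr_div_n ler_pdivrMr ?exprn_gt0// exprAC -exprMn -natrX.
have [I' [y [<- ynorm ysep]]] := separated_iterate r0 xnorm xsep n.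
set rho := r + 2^-1 in ynorm ysep; set mu := _^-1 in ynorm ysep.
have rho0 : 0 < rho by rewrite /rho; lra.
have mu0 : 0 < mu by rewrite invr_gt0.
apply: (le_trans (separated_card_le_grid (ltW rho0) _ _ ysep)).
- by rewrite mulr_gt0 ?exprn_gt0 ?mulr_gt0.
- move=> i; apply: (le_trans (ynorm i)).
  by rewrite ler_piMr ?(ltW rho0)// gerBl exprn_ge0 ?ltW.
have lamn : 1 <= (1 + 2 * r) ^+ n by rewrite exprn_ege1.
have -> : 2 * rho / (2 * rho * mu ^+ n) = (1 + 2 * r) ^+ n.
  rewrite /mu exprVn invfM invrK mulrA divff ?mul1r//.
  by rewrite gt_eqF// mulr_gt0.
rewrite lerXn2r ?nnegrE ?addr_ge0 ?mulr_ge0 ?exprn_ge0 ?(ltW lam0)//.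
by rewrite -[D.+2%:R]natr1; lra.
Qed.

End Packing.

(** A maximal separated subset is a net.  Scaling by [kappa] reduces the bound
    to separation [1] and lets [kappa = 0], a net of infinite radius, be
    treated like any other value: the net is then a single point. *)
Lemma net_exists (R : realType) (D : nat) (X : set 'cV[R]_D) (r kappa : R) :
  0 <= kappa -> X !=set0 -> (forall x, X x -> norm2 x <= r) ->
  exists (m : nat) (p : 'I_m.+1 -> 'cV[R]_D),
    [/\ forall i, X (p i),
        m.+1%:R <= (1 + 2 * (kappa * r)) ^+ D &
        forall x, X x -> exists i, kappa * norm2 (x - p i) <= 1].
Proof.
move=> kappa0 [x0 Xx0] Xr.
have r0 : 0 <= r by exact: le_trans (norm2_ge0 x0) (Xr _ Xx0).
pose separated m := exists p : 'I_m -> 'cV[R]_D, (forall i, X (p i)) /\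
  (forall i j, i != j -> 1 <= kappa * norm2 (p i - p j)).
have separated_le m : separated m -> m%:R <= (1 + 2 * (kappa * r)) ^+ D.
  move=> [p [pX psep]]; rewrite -{1}(card_ord m).
  apply: (@packing_bound _ _ _ (fun i => kappa *: p i)).
  - exact: mulr_ge0.
  - by move=> i; rewrite norm2Z ger0_norm// ler_wpM2l// Xr.
  - by move=> i j /psep; rewrite -scalerBr norm2Z ger0_norm.
have ex1 : exists m, `[< separated m >].
  exists 1%N; apply/asboolP; exists (fun=> x0); split => // i j.
  by rewrite !ord1.
have ub m : `[< separated m >] -> (m <= Num.truncn ((1 + 2 * (kappa * r)) ^+ D))%N.
  move=> /asboolP /separated_le; rewrite truncn_ge_nat// exprn_ge0// addr_ge0//.
  by rewrite !mulr_ge0.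
case: (ex_maxnP ex1 ub) => -[|m] /asboolP sepm maxm.
  have /maxm : `[< separated 1 >]; last by rewrite ltnn.
  by apply/asboolP; exists (fun=> x0); split => // i j; rewrite !ord1.
have [p [pX psep]] := sepm; exists m, p; split => //; first exact: separated_le.
move=> x Xx; apply: contrapT => /forallNP far.
have /maxm : `[< separated m.+2 >]; last by rewrite ltnn.
apply/asboolP; exists (fun i => oapp p x (unlift ord0 i)); split.
  by move=> i; case: unliftP => [i' _|_] /=; [exact: pX|exact: Xx].
move=> i j; case: unliftP => [i' ->|->]; case: unliftP => [j' ->|->] //=.
- by rewrite (inj_eq lift_inj); exact: psep.
- by move=> _; rewrite norm2_distC ltW// ltNge; apply/negP/far.
- by move=> _; rewrite ltW// ltNge; apply/negP/far.
Qed.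

(** * The loss is Lipschitz in the decision *)

Section FiniteMax.
Context {R : realType} {n : nat} (F : 'I_n.+1 -> R).

Lemma le_fmax j : F j <= fmax F.
Proof. exact: le_bigmax. Qed.

Lemma fmax_le c : (forall j, F j <= c) -> fmax F <= c.
Proof. by move=> Fc; apply: bigmax_le. Qed.

Lemma norm_fmax_le : `|fmax F| <= \sum_(j < n.+1) `|F j|.
Proof.
have le_sum j : `|F j| <= \sum_(j < n.+1) `|F j|.
  by rewrite (bigD1 j)//= lerDl sumr_ge0.
rewrite ler_norml; apply/andP; split.
  apply: le_trans (le_fmax ord0); rewrite lerNl (le_trans _ (le_sum ord0))//.
  by rewrite -normrN ler_norm.
by apply: fmax_le => j; exact: le_trans (ler_norm _) (le_sum j).
Qed.

End FiniteMax.

Section Loss.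
Context {R : realType} {Dx Dxi J : nat}.
Context (A : 'I_J.+1 -> 'M[R]_(Dxi, Dx)) (abar : 'I_J.+1 -> 'cV[R]_Dxi).
Context (b : 'I_J.+1 -> 'cV[R]_Dx) (bbar : 'I_J.+1 -> R).

Lemma fmax_opnorm2_ge0 : 0 <= fmax (fun j => opnorm2 (A j)).
Proof. exact: le_trans (opnorm2_ge0 _) (le_fmax _ ord0). Qed.

Lemma fmax_norm2_ge0 : 0 <= fmax (fun j => norm2 (b j)).
Proof. exact: le_trans (norm2_ge0 _) (le_fmax _ ord0). Qed.

Lemma lipschitz_const_ge0 Omega : 0 <= lipschitz_const A b Omega.
Proof.
by rewrite addr_ge0 ?fmax_norm2_ge0// mulr_ge0 ?fmax_opnorm2_ge0 ?sqrtr_ge0.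
Qed.

Lemma loss_lipschitz x x' xi :
  loss A abar b bbar x xi <= loss A abar b bbar x' xi
    + (fmax (fun j => opnorm2 (A j)) * norm2 xi + fmax (fun j => norm2 (b j)))
      * norm2 (x - x').
Proof.
apply: fmax_le => j; rewrite -lerBlDr.
apply: le_trans (le_fmax _ j); rewrite lerBlDr -lerBlDl.
rewrite (_ : _ - _ = ((A j *m (x - x'))^T *m xi) 0 0 + ((b j)^T *m (x - x')) 0 0);
  last first.
  have dotD (u v : 'cV[R]_Dxi) :
      ((u + v)^T *m xi) 0 0 = (u^T *m xi) 0 0 + (v^T *m xi) 0 0.
    by rewrite raddfD/= mulmxDl [LHS]mxE.
  have dotN (u : 'cV[R]_Dxi) : ((- u)^T *m xi) 0 0 = - (u^T *m xi) 0 0.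
    by rewrite raddfN/= mulNmx [LHS]mxE.
  have entryB (u v : 'M[R]_1) : (u - v) 0 0 = u 0 0 - v 0 0 by rewrite !mxE.
  rewrite !mulmxBr entryB !dotD dotN; ring.
rewrite mulrDl lerD//.
  apply: (le_trans (dot_le_norm2 _ _)).
  rewrite mulrAC ler_wpM2r ?norm2_ge0//; apply: (le_trans (norm2_mulmx_le _ _)).
  by rewrite ler_wpM2r ?norm2_ge0// (le_fmax (fun j => opnorm2 (A j))).
apply: (le_trans (dot_le_norm2 _ _)).
by rewrite ler_wpM2r ?norm2_ge0// (le_fmax (fun j => norm2 (b j))).
Qed.

(** The integrals run over the whole space, so integrability of the loss under a
    finite second moment requires a bound outside the support as well. *)
Lemma loss_le_quadratic x :
  exists2 K, 0 <= K & forall xi, `|loss A abar b bbar x xi| <= K * (1 + norm2 xi ^+ 2).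
Proof.
pose k j := norm2 (A j *m x + abar j) + `|((b j)^T *m x) 0 0 + bbar j|.
have k0 j : 0 <= k j by rewrite addr_ge0 ?norm2_ge0.
exists (\sum_j k j) => [|xi]; first by rewrite sumr_ge0.
apply: (le_trans (norm_fmax_le _)); rewrite mulr_suml; apply: ler_sum => j _.
apply: (le_trans (ler_normD _ _)).
have dotN : `|((A j *m x + abar j)^T *m xi) 0 0| <= norm2 (A j *m x + abar j) * norm2 xi.
  rewrite ler_norml dot_le_norm2 andbT lerNl -(norm2N xi).
  by apply: le_trans (dot_le_norm2 _ _); rewrite mulmxN [leRHS]mxE.
apply: (le_trans (lerD dotN (lexx _))); rewrite mulrDl lerD//.
  rewrite ler_wpM2l ?norm2_ge0//.
  by have := sqr_ge0 (norm2 xi - 1); have := sqr_ge0 (norm2 xi); nra.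
by rewrite ler_peMr// lerDl sqr_ge0.
Qed.

End Loss.

(** * Expected losses *)

Section Measurability.
Context {R : realType} {n : nat}.

Lemma measurable_coord (i : 'I_n) :
  measurable_fun [set: borelRn R n] (fun v : borelRn R n => (v : 'cV[R]_n) i 0).
Proof.
apply: (measurability _ (RGenOpens.measurableE R)) => _ [_ [a [c ->]] <-].
rewrite setTI; apply: sub_sigma_algebra.
have := @coord_continuous R n 1 i 0; rewrite continuousP; apply.
exact: interval_open.
Qed.

Lemma measurable_sqr_norm2 :
  measurable_fun [set: borelRn R n] (fun v : borelRn R n => norm2 (v : 'cV[R]_n) ^+ 2).
Proof.
apply: (eq_measurable_fun (fun v : borelRn R n => \sum_(i < n) (v : 'cV[R]_n) i 0 ^+ 2)).
  by move=> v _; rewrite sqr_norm2.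
by apply: measurable_sum => i; apply: measurable_funX; exact: measurable_coord.
Qed.

Lemma measurable_fmax d (T : measurableType d) (m : nat) (F : 'I_m.+1 -> T -> R) :
  (forall j, measurable_fun [set: T] (F j)) ->
  measurable_fun [set: T] (fun t => fmax (F^~ t)).
Proof.
move=> mF; rewrite /fmax; elim: (index_enum _) => [|j s IH].
  by under eq_fun do rewrite big_nil; exact: mF.
by under eq_fun do rewrite big_cons; exact: measurable_maxr.
Qed.

End Measurability.

Lemma measurable_loss (R : realType) (Dx Dxi J : nat)
    (A : 'I_J.+1 -> 'M[R]_(Dxi, Dx)) (abar : 'I_J.+1 -> 'cV[R]_Dxi)
    (b : 'I_J.+1 -> 'cV[R]_Dx) (bbar : 'I_J.+1 -> R) (x : 'cV[R]_Dx) :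
  measurable_fun [set: borelRn R Dxi]
    (fun xi : borelRn R Dxi => loss A abar b bbar x xi).
Proof.
apply: measurable_fmax => j; apply: measurable_funD => //.
apply: (eq_measurable_fun (fun xi : borelRn R Dxi =>
    \sum_(i < Dxi) (A j *m x + abar j) i 0 * (xi : 'cV[R]_Dxi) i 0)).
  by move=> xi _; rewrite mxE; apply: eq_bigr => i _; rewrite [in RHS]mxE.
by apply: measurable_sum => i; apply: measurable_funM => //; exact: measurable_coord.
Qed.

Section SecondMoment.
Context {R : realType} {n : nat} (Q : probability (borelRn R n) R) (Omega : R).
Context (Q_Omega : (second_moment Q <= Omega%:E)%E).

Lemma integrable_sqr_norm2 :
  Q.-integrable setT (fun xi : borelRn R n => (norm2 (xi : 'cV[R]_n) ^+ 2)%:E).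
Proof.
apply/integrableP; split; first by apply/measurable_EFinP; exact: measurable_sqr_norm2.
under eq_integral do rewrite gee0_abs ?lee_fin ?sqr_ge0//.
by apply: le_lt_trans (ltry Omega); move: Q_Omega; rewrite /second_moment unlock.
Qed.

Lemma integrable_quadratic (c k : R) :
  Q.-integrable setT
    (fun xi : borelRn R n => (c + k * norm2 (xi : 'cV[R]_n) ^+ 2)%:E).
Proof.
rewrite (_ : (fun _ => _) = (EFin \o cst c) \+
    (fun xi : borelRn R n => k%:E * (norm2 (xi : 'cV[R]_n) ^+ 2)%:E))%E; last first.
  by apply/funext => xi; rewrite /= EFinD EFinM.
apply: integrableD => //; first exact: finite_measure_integrable_cst.
by apply: integrableZl => //; exact: integrable_sqr_norm2.
Qed.

Lemma integral_quadratic_le (c k : R) : 0 <= k ->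
  (\int[Q]_(xi in setT) (c + k * norm2 (xi : 'cV[R]_n) ^+ 2)%:E
    <= (c + k * Omega)%:E)%E.
Proof.
move=> k0; under eq_integral do rewrite EFinD EFinM.
rewrite integralD//; last 2 first.
- exact: finite_measure_integrable_cst.
- by apply: integrableZl => //; exact: integrable_sqr_norm2.
rewrite integral_cst// integralZl//; last exact: integrable_sqr_norm2.
rewrite [X in (_ * X + _)%E](probability_setT Q) mule1 EFinD EFinM leeD2l// lee_wpmul2l ?lee_fin//.
by move: Q_Omega; rewrite /second_moment unlock.
Qed.

End SecondMoment.

Section ExpectedLoss.
Context {R : realType} {Dx Dxi J : nat}.
Context (A : 'I_J.+1 -> 'M[R]_(Dxi, Dx)) (abar : 'I_J.+1 -> 'cV[R]_Dxi).
Context (b : 'I_J.+1 -> 'cV[R]_Dx) (bbar : 'I_J.+1 -> R).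
Context (Q : probability (borelRn R Dxi) R) (Omega : R).
Context (Q_Omega : (second_moment Q <= Omega%:E)%E).

Lemma integrable_loss x :
  Q.-integrable setT (fun xi : borelRn R Dxi => (loss A abar b bbar x xi)%:E).
Proof.
have [K K0 lossK] := loss_le_quadratic A abar b bbar x.
apply: (le_integrable _ _ _ (integrable_quadratic Q_Omega K K)) => //.
  by apply/measurable_EFinP; exact: measurable_loss.
move=> xi _ /=; rewrite lee_fin (le_trans (lossK xi))// mulrDr mulr1.
exact: ler_norm.
Qed.

Lemma expected_loss_fin_num x : expected_loss (loss A abar b bbar) Q x \is a fin_num.
Proof.
by rewrite /expected_loss unlock; apply: integrable_fin_num => //; exact: integrable_loss.
Qed.

(** The random Lipschitz constant of [loss_lipschitz] is affine in the norm of
    [xi].  Instead of Jensen's inequality for the square root, the pointwise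
    bound [norm2 xi <= (s + norm2 xi ^+ 2 / s) / 2] is integrated; it is optimal
    for [s = Num.sqrt Omega]. *)
Lemma expected_loss_lipschitz x x' : 0 < Omega ->
  (expected_loss (loss A abar b bbar) Q x <=
   expected_loss (loss A abar b bbar) Q x'
   + (lipschitz_const A b Omega * norm2 (x - x'))%:E)%E.
Proof.
move=> Omega0; set s := Num.sqrt Omega; set dist := norm2 (x - x').
set a := fmax (fun j => opnorm2 (A j)); set beta := fmax (fun j => norm2 (b j)).
have s0 : 0 < s by rewrite sqrtr_gt0.
have sqs : s ^+ 2 = Omega by rewrite sqr_sqrtr ?ltW.
have a0 : 0 <= a := fmax_opnorm2_ge0 A.
have dist0 : 0 <= dist := norm2_ge0 _.
pose c := (a * (s / 2) + beta) * dist; pose k := a / (2 * s) * dist.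
have k0 : 0 <= k by rewrite mulr_ge0// divr_ge0// mulr_ge0// ltW.
have -> : lipschitz_const A b Omega * dist = c + k * Omega.
  rewrite /c /k /lipschitz_const -/a -/beta -/s -sqs; field.
  by rewrite gt_eqF.
apply: le_trans (leeD2l _ (integral_quadratic_le Q_Omega c k0)).
rewrite /expected_loss unlock -integralD//; last 2 first.
- exact: integrable_loss.
- exact: (integrable_quadratic Q_Omega).
apply: le_integral => //.
- exact: integrable_loss.
- by apply: integrableD => //; [exact: integrable_loss|exact: (integrable_quadratic Q_Omega)].
move=> xi _; rewrite -EFinD lee_fin (le_trans (loss_lipschitz A abar b bbar x x' xi))//.
rewrite lerD2l -/a -/beta -/dist.
have -> : c + k * norm2 xi ^+ 2
    = (a * ((s + norm2 xi ^+ 2 / s) / 2) + beta) * dist.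
  by rewrite /c /k; field; rewrite gt_eqF.
rewrite ler_wpM2r// lerD2r ler_wpM2l// -subr_ge0.
have -> : (s + norm2 xi ^+ 2 / s) / 2 - norm2 xi = (norm2 xi - s) ^+ 2 / (2 * s).
  by field; rewrite gt_eqF.
by rewrite divr_ge0 ?sqr_ge0// mulr_ge0// ltW.
Qed.

End ExpectedLoss.

(** * High-probability events *)

Section HighProbability.
Context {R : realType} {d : measure_display} {T : measurableType d}.
Context (P : probability T R).
Implicit Types E : set T.

Lemma with_prob_subset (p : R) E E' :
  E `<=` E' -> with_prob_at_least P p E -> with_prob_at_least P p E'.
Proof. by move=> EE' [F [mF FE pF]]; exists F; split => //; exact: subset_trans EE'. Qed.

(** Union bound: failure probabilities add up.  It is applied to the measurable
    events inside [E] and [E'], which themselves need not be measurable. *)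
Lemma with_probI (r r' : R) E E' :
  with_prob_at_least P (1 - r) E -> with_prob_at_least P (1 - r') E' ->
  with_prob_at_least P (1 - (r + r')) (E `&` E').
Proof.
have compl_le F t : measurable F -> ((1 - t)%:E <= P F)%E = (P (~` F) <= t%:E)%E.
  move=> mF; rewrite probability_setC// -(fineK (fin_num_measure P F mF)).
  by rewrite -EFinB !lee_fin; apply/idP/idP; lra.
move=> [F [mF FE PF]] [F' [mF' FE' PF']]; exists (F `&` F').
have mFF' : measurable (F `&` F') by exact: measurableI.
split => //; first exact: setISS.
rewrite compl_le// setCI; apply: (le_trans (measureU2 _ _ _)).
- exact: measurableC.
- exact: measurableC.
by rewrite EFinD; apply: leeD; rewrite -compl_le.
Qed.

Lemma with_prob_ae (E : set T) : {ae P, forall w, E w} -> with_prob_at_least P (1 - 0) E.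
Proof.
move=> [F [mF PF0 EF]]; exists (~` F); split.
- exact: measurableC.
- by move=> w Fw; apply: contrapT => /EF.
- by rewrite probability_setC// PF0 sube0 subr0.
Qed.

Lemma with_prob_forall (m : nat) (E : 'I_m -> set T) (r : R) :
  (forall i, with_prob_at_least P (1 - r) (E i)) ->
  with_prob_at_least P (1 - m%:R * r) [set w | forall i, E i w].
Proof.
elim: m E => [|m IH] E PE.
  rewrite mul0r; exists setT; split=> //; first by move=> w _ [].
  by rewrite probability_setT subr0.
rewrite -natr1 mulrDl mul1r.
apply: with_prob_subset (with_probI (IH _ (fun i => PE (lift ord_max i))) (PE ord_max)).
by move=> w [Ei Em] i; case: (unliftP ord_max i) => [j|] ->; [exact: Ei|].
Qed.

End HighProbability.

(** * From the net to the whole decision set *)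

Lemma second_moment_ge0 (R : realType) (n : nat) (Q : probability (borelRn R n) R) :
  (0 <= second_moment Q)%E.
Proof. by apply: expectation_ge0 => xi; exact: sqr_ge0. Qed.

Theorem proposition2 (R : realType) (Dx Dxi J N : nat) (N_gt0 : (0 < N)%N)
  (X : set 'cV[R]_Dx) (X_compact : compact X)
  (X_convex : @convex_set R 'cV[R]_Dx X)
  (Xi : set 'cV[R]_Dxi) (Xi_meas : measurable (Xi : set (borelRn R Dxi)))
  (A : 'I_J.+1 -> 'M[R]_(Dxi, Dx)) (abar : 'I_J.+1 -> 'cV[R]_Dxi)
  (b : 'I_J.+1 -> 'cV[R]_Dx) (bbar : 'I_J.+1 -> R)
  (c1 c2 : R) (c1_ge0 : 0 <= c1) (c2_ge0 : 0 <= c2)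
  (loss_growth : forall x xi, X x -> Xi xi ->
     `|loss A abar b bbar x xi| <= c1 + c2 * norm2 xi)
  (Z : probability (borelRn R Dx) R) (Z_full : full_support X Z)
  (Omega : R)
  (Pstar : probability (borelRn R Dxi) R) (Pstar_Xi : probs_on Xi Pstar)
  (Pstar_Omega : (second_moment Pstar <= Omega%:E)%E)
  (* the random data, and the reference distribution built from the sample *)
  (d dS : measure_display) (T : measurableType d) (S : measurableType dS)
  (Pr : probability T R) (data : 'I_N -> {RV Pr >-> S})
  (est : ('I_N -> S) -> probability (borelRn R Dxi) R)
  (Phat : T -> probability (borelRn R Dxi) R)
  (Phat_def : forall w, Phat w = est (fun i => data i w))
  (Phat_Xi : forall w, probs_on Xi (Phat w))
  (Phat_Omega : {ae Pr, forall w, (second_moment (Phat w) < Omega%:E)%E})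
  (Rx : R) (Rx_bound : forall x, X x -> norm2 x <= Rx)
  (e : R -> R)
  (e_ge0 : forall t, 0 <= t -> 0 <= e t)
  (e_nondecr : forall s t, 0 <= s -> s <= t -> e s <= e t)
  (e_growth : poly_growth e)
  (pointwise_bound : forall z, X z -> forall delta : R, 0 < delta < 1 ->
     with_prob_at_least Pr (1 - delta)
       [set w | (expected_loss (loss A abar b bbar) Pstar z
                 - expected_loss (loss A abar b bbar) (Phat w) z
                 <= (1 / Num.sqrt N%:R * e (ln (1 / delta)))%:E)%E]) :
  let L := lipschitz_const A b Omega in
  forall delta : R, 0 < delta < 1 ->
  let eps := 1 / Num.sqrt N%:R *
    (e (Dx%:R * ln (1 + 2 * Rx * L * Num.sqrt N%:R) + ln (1 / delta)) + 2) in
  with_prob_at_least Pr (1 - delta)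
    [set w | ambiguity_set X Xi (loss A abar b bbar) Z Omega (Phat w) eps Pstar].
Proof.
move=> L delta /andP[delta0 delta1] eps.
have X_ne : X !=set0.
  apply/set0P; apply/negP => /eqP X0; have := Z_full.1.
  by rewrite /probs_on /= X0 measure0 => /eqP; rewrite eqe eq_sym oner_eq0.
have [x0 Xx0] := X_ne.
have Rx0 : 0 <= Rx := le_trans (norm2_ge0 x0) (Rx_bound x0 Xx0).
have L0 : 0 <= L := lipschitz_const_ge0 A b Omega.
set sN := Num.sqrt N%:R in pointwise_bound eps *.
have sN0 : 0 < sN by rewrite sqrtr_gt0 ltr0n.
have kappa0 : 0 <= L * sN by rewrite mulr_ge0// ltW.
have [m [p [pX card_p net_p]]] := net_exists kappa0 X_ne Rx_bound.
have M0 : 0 < m.+1%:R :> R by [].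
have M1 : 1 <= m.+1%:R :> R by rewrite ler1n.
pose q := delta / m.+1%:R.
have q01 : 0 < q < 1.
  by rewrite divr_gt0//= ltr_pdivrMr// mul1r (lt_le_trans delta1).
have on_net := with_prob_forall (fun i => pointwise_bound (p i) (pX i) q q01).
have := with_probI on_net (with_prob_ae Phat_Omega).
rewrite addr0 mulrC divfK ?gt_eqF//.
apply: with_prob_subset => w [/= bound_p Phat_w].
have Omega0 : 0 < Omega.
  by rewrite -lte_fin (le_lt_trans (second_moment_ge0 (Phat w))).
(* the union bound costs the logarithm of the size of the net *)
have e_net : e (ln (1 / q)) <= e (Dx%:R * ln (1 + 2 * Rx * L * sN) + ln (1 / delta)).
  have q1 : 1 <= 1 / q by rewrite ler_pdivlMr ?mul1r; case/andP: q01 => // _ /ltW.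
  apply: e_nondecr; first exact: ln_ge0.
  have -> : 1 / q = m.+1%:R * (1 / delta) by rewrite /q; field; rewrite !gt_eqF.
  rewrite lnM ?posrE ?divr_gt0// lerD2r.
  rewrite (_ : 1 + 2 * Rx * L * sN = 1 + 2 * (L * sN * Rx)); last by ring.
  have base0 : 0 < 1 + 2 * (L * sN * Rx) by rewrite ltr_pwDl// !mulr_ge0// ltW.
  by rewrite mulr_natl -lnXn// ler_ln ?posrE ?exprn_gt0.
split => //; rewrite (_ : \int[Z]_(z in X) _ = 0)%E//.
apply: integral0_eq => z Xz.
apply/max_idPr; have [i zi] := net_p _ Xz.
have step : L * norm2 (z - p i) <= 1 / sN by rewrite ler_pdivlMr// mulrAC.
have := expected_loss_lipschitz A abar b bbar Pstar_Omega z (p i) Omega0.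
have := expected_loss_lipschitz A abar b bbar (ltW Phat_w) (p i) z Omega0.
have := bound_p i; rewrite norm2_distC -/L.
have finS y := expected_loss_fin_num A abar b bbar Pstar_Omega y.
have finH y := expected_loss_fin_num A abar b bbar (ltW Phat_w) y.
rewrite -(fineK (finS z)) -(fineK (finS (p i))).
rewrite -(fineK (finH z)) -(fineK (finH (p i))).
rewrite -!EFinB -!EFinD !lee_fin.
have : 1 / sN * e (ln (1 / q)) + 2 * (1 / sN) <= eps.
  by rewrite /eps mulrDr [2 * _]mulrC lerD2r ler_wpM2l// divr_ge0// ltW.
by lra.
Qed.
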